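(* Let $F$ be a non-empty bounded subset of $\mathbb{R}^n$ and let $0\leq \theta<\phi \leq 1$. Then $$\underline{\dim}_{\theta} F \ \leq \ \underline{\dim}_{\phi} F \ \leq \ \underline{\dim}_{\theta} F +\Big(1-\frac{\theta}{\phi}\Big) (n- \underline{\dim}_{\theta} F)$$ and $$\overline{\dim}_{\theta} F \ \leq \ \overline{\dim}_{\phi} F \ \leq \ \overline{\dim}_{\theta} F +\Big(1-\frac{\theta}{\phi}\Big) (n- \overline{\dim}_{\theta} F).$$ In particular, $\theta \mapsto \underline{\dim}_{\theta} F$ and $\theta \mapsto \overline{\dim}_{\theta} F$ are continuous for $\theta \in (0,1]$.
   Context: For a set $U\subseteq\mathbb{R}^n$, $|U|$ denotes its diameter. A cover $\{U_i\}$ of $F$ is a finite or countable collection of sets with $F\subseteq\bigcup_i U_i$. For bounded $F\subseteq\mathbb{R}^n$ and $0\leq\theta\leq 1$, the lower $\theta$-intermediate dimension $\underline{\dim}_{\theta} F$ is the infimum of all $s\geq 0$ such that for all $\epsilon>0$ and all $\delta_0>0$ there exist $0<\delta\leq\delta_0$ and a cover $\{U_i\}$ of $F$ with $\delta^{1/\theta}\leq |U_i|\leq\delta$ for all $i$ and $\sum_i |U_i|^s\leq\epsilon$. The upper $\theta$-intermediate dimension $\overline{\dim}_{\theta} F$ is the infimum of all $s\geq 0$ such that for all $\epsilon>0$ there exists $\delta_0>0$ such that for all $0<\delta\leq\delta_0$ there is a cover $\{U_i\}$ of $F$ with $\delta^{1/\theta}\leq |U_i|\leq\delta$ for all $i$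 and $\sum_i |U_i|^s\leq\epsilon$. When $\theta=0$, $\delta^{1/\theta}$ is read as $0$ (no lower restriction on diameters), so that $\underline{\dim}_0F=\overline{\dim}_0F$ is the Hausdorff dimension of $F$; when $\theta=1$ these are the lower and upper box dimensions. *)

(* Defs.v *)
From HB Require Import structures.
From mathcomp Require Import all_boot all_order all_algebra.
From mathcomp Require Import all_classical all_reals all_analysis.

Set Implicit Arguments.
Unset Strict Implicit.
Unset Printing Implicit Defensive.

Import Order.TTheory GRing.Theory Num.Theory.
Import numFieldNormedType.Exports.

Local Open Scope classical_set_scope.
Local Open Scope ring_scope.

Section IntermediateDimensions.
Context {R : realType} {n : nat}.
Implicit Types (F U : set 'rV[R]_n) (theta delta s eps : R).

(* The norm that the library puts on ['rV[R]_n] is the sup norm, so the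
   Euclidean distance is spelled out. *)
Definition eucl_dist (x y : 'rV[R]_n) : R :=
  Num.sqrt (\sum_(i < n) (x ord0 i - y ord0 i) ^+ 2).

(* The maximum with 0 only matters for [U = set0]: [ereal_sup set0 = -oo], while
   the empty set has diameter 0. *)
Definition diam U : \bar R :=
  maxe 0%E (ereal_sup [set (eucl_dist x y)%:E | x in U & y in U]).

Definition lower_scale theta delta : R :=
  if theta == 0 then 0 else delta `^ theta^-1.

(* Finite and countable covers are families indexed by a set [I] of naturals:
   padding a finite cover with empty sets would violate the lower bound on the
   diameters when [theta > 0]. *)
Definition has_cover F theta delta s eps : Prop :=
  exists (I : set nat) (U : nat -> set 'rV[R]_n),
    [/\ F `<=` \bigcup_(i in I) U i,
        forall i, I i ->
          ((lower_scale theta delta)%:E <= diam (U i) <= delta%:E)%E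
      & (\esum_(i in I) (diam (U i) `^ s) <= eps%:E)%E].

(* The infima are taken in [\bar R], where [ereal_inf set0 = +oo]. *)
Definition lower_idim F theta : \bar R :=
  ereal_inf [set s%:E | s in [set s : R | 0 <= s /\
    forall eps, 0 < eps -> forall delta0, 0 < delta0 ->
      exists delta, 0 < delta <= delta0 /\ has_cover F theta delta s eps]].

Definition upper_idim F theta : \bar R :=
  ereal_inf [set s%:E | s in [set s : R | 0 <= s /\
    forall eps, 0 < eps -> exists delta0, 0 < delta0 /\
      forall delta, 0 < delta <= delta0 -> has_cover F theta delta s eps]].

End IntermediateDimensions.

(* Main.v *)
(** If [F] has a cover by sets with diameters in [[delta^(1/theta), delta]],
    keep the sets of diameter at most [delta' = delta^(phi/theta)] and cut every
    larger set [U] into at most [K (|U|/delta')^n] cubes of diameter exactly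
    [delta'].  Since [delta'^(1/phi) = delta^(1/theta)], the new cover is
    admissible for [phi] at scale [delta'], and the choice
    [t = n - (theta/phi) (n - s)] makes the new sum of [t]-th powers at most [K]
    times the old sum of [s]-th powers.  So every [s <= n] admissible for
    [theta] yields [t] admissible for [phi].  Monotonicity in [theta] is
    immediate for [delta <= 1], a grid of cubes shows that every exponent above
    [n] is admissible, and on ]0, 1] both inequalities together give a local
    Lipschitz bound, hence continuity. *)

Require Import Defs.
From HB Require Import structures.
From mathcomp Require Import all_boot all_order all_algebra.
From mathcomp Require Import all_classical all_reals all_analysis.
From mathcomp Require Import ring lra.

Import Order.TTheory GRing.Theory Num.Theory.
Import numFieldNormedType.Exports.

Local Open Scope classical_set_scope.
Local Open Scope ring_scope.

(** * Euclidean distance, diameters and cubes *)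

Lemma coord_le_eucl {R : realType} {n : nat} (x y : 'rV[R]_n) (i : 'I_n) :
  `|x ord0 i - y ord0 i| <= eucl_dist x y.
Proof.
rewrite -sqrtr_sqr; apply: ler_wsqrtr.
rewrite [leRHS](bigD1 i)//= lerDl; apply: sumr_ge0 => j _; exact: sqr_ge0.
Qed.

Lemma eucl_dist_le_sup {R : realType} {n : nat} (x y : 'rV[R]_n) (h : R) :
  0 <= h -> (forall i, `|x ord0 i - y ord0 i| <= h) ->
  eucl_dist x y <= Num.sqrt n%:R * h.
Proof.
move=> h0 xyh; rewrite -[X in _ * X](ger0_norm h0) -sqrtr_sqr -sqrtrM//.
apply: ler_wsqrtr; rewrite mulr_natl.
apply: le_trans (_ : \sum_(i < n) h ^+ 2 <= _); last first.
  by rewrite sumr_const card_ord.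
by apply: ler_sum => i _; rewrite -real_normK ?num_real// lerXn2r ?nnegrE.
Qed.

Lemma diam_ge0 {R : realType} {n : nat} (U : set 'rV[R]_n) : (0 <= diam U)%E.
Proof. by rewrite /diam le_max lexx. Qed.

Lemma eucl_dist_le_diam {R : realType} {n : nat} (U : set 'rV[R]_n) x y :
  U x -> U y -> ((eucl_dist x y)%:E <= diam U)%E.
Proof.
move=> Ux Uy; rewrite /diam le_max; apply/orP; right.
by apply: ereal_sup_ubound; exists x => //; exists y.
Qed.

Lemma diam_le {R : realType} {n : nat} (U : set 'rV[R]_n) (r : R) : 0 <= r ->
  (forall x y, U x -> U y -> eucl_dist x y <= r) -> (diam U <= r%:E)%E.
Proof.
move=> r0 Ur; rewrite /diam ge_max lee_fin r0/=.
by apply: ge_ereal_sup => _ [x Ux [y Uy <-]]; rewrite lee_fin; apply: Ur.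
Qed.

Definition cube {R : realType} {n : nat} (a : 'I_n -> R) (h : R) :
  set 'rV[R]_n := [set x | forall i, a i <= x ord0 i <= a i + h].

Lemma diam_cube {R : realType} {n : nat} (a : 'I_n -> R) (h : R) :
  0 <= h -> diam (cube a h) = (Num.sqrt n%:R * h)%:E.
Proof.
move=> h0; apply/eqP; rewrite eq_le; apply/andP; split.
  apply: diam_le => [|x y ax ay]; first by rewrite mulr_ge0// sqrtr_ge0.
  apply: eucl_dist_le_sup => // i.
  by have := ax i; have := ay i; rewrite ler_norml; lra.
(* Two opposite corners attain the diameter. *)
pose x : 'rV[R]_n := \row_i (a i + h); pose y : 'rV[R]_n := \row_i a i.
have -> : Num.sqrt n%:R * h = eucl_dist x y.
  rewrite /eucl_dist (eq_bigr (fun=> h ^+ 2)) => [|i _]; last first.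
    by rewrite !mxE; congr (_ ^+ 2); ring.
  by rewrite sumr_const card_ord -[in RHS]mulr_natl sqrtrM// sqrtr_sqr ger0_norm.
by apply: eucl_dist_le_diam => i; rewrite !mxE; lra.
Qed.

(** * Scales and operations on covers *)

Lemma lower_scale_ge0 {R : realType} (theta delta : R) :
  0 <= lower_scale theta delta.
Proof. by rewrite /lower_scale; case: ifP => // _; exact: powR_ge0. Qed.

(** A base at most 1 raised to the decreasing exponent [theta^-1] gives a power increasing in
    [theta]; at [theta = 0] the scale is 0 by convention. *)
Lemma le_lower_scale {R : realType} (theta phi delta : R) :
  0 <= theta <= phi -> 0 < delta <= 1 ->
  lower_scale theta delta <= lower_scale phi delta.
Proof.
move=> /andP[t0 tp] d01; rewrite {1}/lower_scale; case: eqP => [|/eqP tN0].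
  by move=> _; exact: lower_scale_ge0.
have {tN0}t0 : 0 < theta by lra.
rewrite /lower_scale gt_eqF; last exact: lt_le_trans tp.
by apply: ger_powR => //; rewrite lef_pV2// posrE; apply: lt_le_trans tp.
Qed.

Lemma lower_scale_le {R : realType} (phi delta : R) :
  0 <= phi <= 1 -> 0 < delta <= 1 -> lower_scale phi delta <= delta.
Proof.
move=> p01 d01; apply: le_trans (le_lower_scale phi 1 delta p01 d01) _.
by rewrite /lower_scale oner_eq0 invr1 powRr1//; lra.
Qed.

Lemma has_cover_le {R : realType} {n : nat} (F : set 'rV[R]_n)
    (theta phi delta s eps eps' : R) :
  0 <= theta <= phi -> 0 < delta <= 1 -> eps <= eps' ->
  has_cover F phi delta s eps -> has_cover F theta delta s eps'.
Proof.
move=> tp d01 ee [I [U [FU Ubnd Usum]]]; exists I, U; split => //.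
  move=> i /Ubnd/andP[lU ->]; rewrite andbT; apply: le_trans lU.
  by rewrite lee_fin; exact: le_lower_scale.
by apply: le_trans Usum _; rewrite lee_fin.
Qed.

Lemma esumZ_le {R : realType} {T : choiceType} (I : set T) (a : T -> \bar R)
    (K : R) : 0 <= K -> (forall i, (0 <= a i)%E) ->
  (\esum_(i in I) (K%:E * a i) <= K%:E * \esum_(i in I) a i)%E.
Proof.
move=> K0 a0; apply: ge_ereal_sup => _ [A finA <-].
rewrite -ge0_mule_fsumr//; apply: lee_wpmul2l; first by rewrite lee_fin.
by apply: ereal_sup_ubound; exists A.
Qed.

Lemma has_cover_self {R : realType} {n : nat} (U : set 'rV[R]_n)
    (phi delta s : R) :
  ((lower_scale phi delta)%:E <= diam U <= delta%:E)%E ->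
  has_cover U phi delta s (fine (diam U) `^ s).
Proof.
move=> Ubnd; have Ufin : diam U \is a fin_num.
  rewrite ge0_fin_numE ?diam_ge0//.
  by case/andP: Ubnd => _ /le_lt_trans->//; exact: ltry.
exists [set 0%N], (fun=> U); split => //.
  by move=> x Ux; exists 0%N.
by rewrite esum_set1 ?poweR_ge0// -poweR_EFin fineK.
Qed.
(** Covering each set of a given cover separately and taking all the pieces reduces the refinement
    of a cover to a bound for a single set [U]. *)
Lemma has_cover_trans {R : realType} {n : nat} (F : set 'rV[R]_n)
    (theta phi delta delta' s t eps K : R) : 0 <= K ->
  (forall U : set 'rV[R]_n,
    ((lower_scale theta delta)%:E <= diam U <= delta%:E)%E ->
    has_cover U phi delta' t (K * fine (diam U) `^ s)) ->
  has_cover F theta delta s eps -> has_cover F phi delta' t (K * eps).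
Proof.
move=> K0 coverU [I [U [FU Ubnd Usum]]].
have /choice[f fP] i : exists JV : set nat * (nat -> set 'rV[R]_n), I i ->
    [/\ U i `<=` \bigcup_(j in JV.1) JV.2 j,
      forall j, JV.1 j ->
        ((lower_scale phi delta')%:E <= diam (JV.2 j) <= delta'%:E)%E
      & (\esum_(j in JV.1) (diam (JV.2 j) `^ t) <= K%:E * diam (U i) `^ s)%E].
  have [Ii|nIi] := pselect (I i); last by exists (set0, fun=> set0).
  have [J [V [UV Vbnd Vsum]]] := coverU _ (Ubnd _ Ii).
  exists (J, V) => _; split => //=; apply: le_trans Vsum _.
  rewrite EFinM -poweR_EFin fineK// ge0_fin_numE ?diam_ge0//.
  by case/andP: (Ubnd _ Ii) => _ /le_lt_trans->//; exact: ltry.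
(* The pieces are indexed by pairs; [pickle] codes these injectively as naturals, so the sum over
   codes is a double sum. *)
pose A := I `*`` (fun i => (f i).1).
pose W k := if unpickle k is Some p then (f p.1).2 p.2 else set0.
have WE (p : nat * nat) : W (pickle p) = (f p.1).2 p.2 by rewrite /W pickleK.
exists (pickle @` A), W; split.
- move=> x /FU[i Ii Uix]; have [+ _ _] := fP i Ii.
  move=> /(_ _ Uix)[j Jj Vx].
  by exists (pickle (i, j)); [exists (i, j)|rewrite WE].
- move=> _ [[i j] [/= Ii Jj] <-]; rewrite WE/=.
  by have [_ + _] := fP i Ii; exact.
rewrite esum_image; last by move=> p q _ _; exact: (pcan_inj pickleK).
under eq_esum do rewrite WE.
rewrite -(@esum_esum _ _ _ _ _ (fun i j => diam ((f i).2 j) `^ t)%E); last first.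
  by move=> *; exact: poweR_ge0.
apply: (@le_trans _ _ (\esum_(i in I) (K%:E * diam (U i) `^ s))%E).
  by apply: le_esum => i Ii; have [] := fP i Ii.
apply: le_trans (esumZ_le _ _ _ K0 _) _ => [i|]; first exact: poweR_ge0.
by rewrite EFinM; apply: lee_wpmul2l.
Qed.

(** * Covering a box by a grid of cubes *)

(** A side of length [2 * r] meets at most [2 * sqrt n * (r / rho) + 1] grid cells of side
    [rho / sqrt n]. As [1 <= r / rho], this is at most [(2 * sqrt n + 1) * (r / rho)]; the [n]-th
    power counts the cubes. *)
Definition box_cst (R : realType) (n : nat) : R := (2 * Num.sqrt n%:R + 1) ^+ n.

Lemma box_cst_ge1 (R : realType) (n : nat) : 1 <= box_cst R n.
Proof. by apply: exprn_ege1; rewrite lerDr mulr_ge0// sqrtr_ge0. Qed.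

Lemma box_cst_gt0 (R : realType) (n : nat) : 0 < box_cst R n.
Proof. exact: lt_le_trans ltr01 (box_cst_ge1 R n). Qed.

(* The cubes have diameter exactly [rho], as the case [phi = 1] requires. *)
Lemma has_cover_box {R : realType} {n : nat} (U : set 'rV[R]_n) (p : 'rV[R]_n)
    (r rho phi t : R) : (0 < n)%N ->
  0 <= phi <= 1 -> 0 < rho <= 1 -> rho <= r ->
  (forall x, U x -> forall i, `|x ord0 i - p ord0 i| <= r) ->
  has_cover U phi rho t (box_cst R n * (r / rho) ^+ n * rho `^ t).
Proof.
move=> n0 p01 /[dup] rho01 /andP[rho0 rho1] rhor Ur.
set c : R := Num.sqrt n%:R; have c0 : 0 < c by rewrite sqrtr_gt0 ltr0n.
pose h := rho / c; have h0 : 0 < h by rewrite divr_gt0.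
(* The successor leaves room for the index [truncn (2 * r / h)], which points on the far face of the
   box can reach. *)
pose m := (Num.truncn (2 * r / h)).+1.
pose V (g : {ffun 'I_n -> 'I_m}) :=
  cube (fun i => p ord0 i - r + (g i)%:R * h) h.
have diamV g : diam (V g) = rho%:E.
  by rewrite diam_cube ?ltW// /h mulrC divfK// gt_eqF.
pose W k := if unpickle k is Some g then V g else set0.
have WE g : W (pickle g) = V g by rewrite /W pickleK.
exists (range (pickle : {ffun 'I_n -> 'I_m} -> nat)), W; split.
- move=> x Ux.
  have xr i : 0 <= (x ord0 i - p ord0 i + r) / h <= 2 * r / h.
    have := Ur x Ux i; rewrite ler_norml => ?.
    by rewrite divr_ge0 ?(ltW h0)//= ?ler_pM2r ?invr_gt0//; lra.
  pose k i := Num.truncn ((x ord0 i - p ord0 i + r) / h).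
  have km i : (k i < m)%N.
    by rewrite ltnS; apply: le_truncn; have /andP[] := xr i.
  pose g : {ffun 'I_n -> 'I_m} := [ffun i => Ordinal (km i)].
  exists (pickle g); first by exists g.
  rewrite WE => i; rewrite ffunE/=.
  have /andP[/truncn_itv + _] := xr i; rewrite -/(k i).
  rewrite ler_pdivlMr// ltr_pdivrMr// -natr1; nra.
- move=> _ [g _ <-]; rewrite WE diamV !lee_fin lexx andbT.
  exact: lower_scale_le.
rewrite esum_image; last by move=> g g' _ _; exact: (pcan_inj pickleK).
under eq_esum do rewrite WE diamV poweR_EFin.
rewrite esum_fset; [|exact: finite_finset|]; last first.
  by move=> *; rewrite lee_fin powR_ge0.
have -> : [set: {ffun 'I_n -> 'I_m}] = [set` enum {ffun 'I_n -> 'I_m}].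
  by apply/seteqP; split => // g _ /=; rewrite mem_enum.
rewrite -fsbig_seq ?enum_uniq// sumEFin big_enum sumr_const card_ffun !card_ord.
rewrite lee_fin -[leLHS]mulr_natl natrX -exprMn.
apply: ler_wpM2r; first exact: powR_ge0.
rewrite lerXn2r ?nnegrE//; first by rewrite mulr_ge0 ?divr_ge0//; lra.
rewrite /m -natr1; have rh : 2 * r / h = 2 * c * (r / rho).
  by rewrite /h; field; rewrite !gt_eqF.
have : (Num.truncn (2 * r / h))%:R <= 2 * r / h.
  by rewrite truncn_le divr_ge0//; lra.
have : 1 <= r / rho by rewrite ler_pdivlMr// mul1r.
rewrite rh => q1 cq; rewrite [leRHS]mulrDl mul1r; exact: lerD.
Qed.

(** * Refining a cover from [theta] to [phi] *)

(** The exponent [t] is tuned so that [(r / delta')^n * delta'^t = r^s * (r / delta)^(n - s)], which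
    is at most [r^s] because [r <= delta] and [s <= n]. *)
Lemma has_cover_refine {R : realType} {n : nat} (F : set 'rV[R]_n)
    (theta phi delta s eps : R) : (0 < n)%N ->
  0 < theta -> theta < phi -> phi <= 1 -> 0 < delta <= 1 -> s <= n%:R ->
  has_cover F theta delta s eps ->
  has_cover F phi (delta `^ (phi / theta)) (n%:R - theta / phi * (n%:R - s))
    (box_cst R n * eps).
Proof.
move=> n0 t0 tp p1 /[dup] d01 /andP[d0 d1] sn.
have p0 : 0 < phi by exact: lt_trans tp.
set K := box_cst R n; set t := n%:R - _; set delta' := delta `^ (phi / theta).
have K1 : 1 <= K by exact: box_cst_ge1.
have K0 : 0 <= K by apply: le_trans K1.
have d'0 : 0 < delta' by exact: powR_gt0.
have d'1 : delta' <= delta.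
  by apply: ge1r_powR => //; rewrite ler_pdivlMr// mul1r ltW.
have d'01 : 0 < delta' <= 1 by rewrite d'0 (le_trans d'1).
(* This serves the sets that are kept: [r <= 1] then gives [r^t <= r^s]. *)
have st : s <= t.
  have : theta / phi <= 1 by rewrite ler_pdivrMr// mul1r ltW.
  by rewrite /t; nra.
have scaleE : lower_scale phi delta' = lower_scale theta delta.
  rewrite /lower_scale !gt_eqF// -powRrM.
  by congr (_ `^ _); field; rewrite !gt_eqF.
apply: has_cover_trans => // U; set r := fine (diam U).
move=> Ubnd; have diamE : diam U = r%:E.
  rewrite fineK// ge0_fin_numE ?diam_ge0//.
  by case/andP: Ubnd => _ /le_lt_trans->//; exact: ltry.
move: (Ubnd); rewrite diamE !lee_fin => /andP[lr rd].
have r0 : 0 < r.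
  by apply: lt_le_trans lr; rewrite /lower_scale gt_eqF// powR_gt0.
have r01 : 0 < r <= 1 by rewrite r0 (le_trans rd).
have [rd'|d'r] := leP r delta'.
  apply: (has_cover_le U phi phi delta' t (r `^ t) (K * r `^ s)) => //.
    by rewrite lexx ltW.
    by apply: le_trans (ler_peMl (powR_ge0 _ _) K1); exact: ger_powR.
  by apply: has_cover_self; rewrite diamE !lee_fin scaleE lr.
have [p Up] : exists p : 'rV[R]_n,
    forall x, U x -> forall i, `|x ord0 i - p ord0 i| <= r.
  have [[p Up]|U0] := pselect (U !=set0); last first.
    by exists 0 => x Ux; case: U0; exists x.
  exists p => x Ux i; apply: le_trans (coord_le_eucl _ _ _) _.
  by rewrite -lee_fin -diamE; exact: eucl_dist_le_diam.
apply: (has_cover_le U phi phi delta' t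
  (K * (r / delta') ^+ n * delta' `^ t) (K * r `^ s)) => //.
- by rewrite lexx ltW.
- rewrite -mulrA; apply: ler_wpM2l => //.
  rewrite exprMn exprVn -!powR_mulrn ?(ltW r0) ?(ltW d'0)// -mulrA.
  rewrite [_^-1 * _]mulrC -powRB ?(gt_eqF d'0) ?implybT//.
  (* Here [t - n = - (theta / phi) * (n - s)], and the factor [theta / phi] cancels the exponent
     [phi / theta] in [delta']. *)
  have -> : delta' `^ (t - n%:R) = (delta `^ (n%:R - s))^-1.
    rewrite -powRN /delta' -powRrM /t.
    by congr (_ `^ _); field; rewrite !gt_eqF.
  rewrite ler_pdivrMr ?powR_gt0//.
  have -> : r `^ n%:R = r `^ s * r `^ (n%:R - s).
    by rewrite -powRD ?(gt_eqF r0) ?implybT// subrKC.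
  apply: ler_wpM2l; first exact: powR_ge0.
  by apply: ge0_ler_powR; rewrite ?nnegrE ?subr_ge0// ltW.
- by apply: (has_cover_box U p r) => //; [rewrite ltW|exact: ltW].
Qed.

(** * Admissible exponents *)

(** Taking [M] at least 1 ensures [delta <= M] for every scale [delta <= 1], as the grid cover of a
    box demands. *)
Lemma bounded_set_coord {R : realType} {n : nat} (F : set 'rV[R]_n) :
  bounded_set F ->
  exists2 M : R, 1 <= M & forall x, F x -> forall i, `|x ord0 i| <= M.
Proof.
move=> [M0 [_ FM]]; exists (Num.max 1 (M0 + 1)); first by rewrite le_max lexx.
move=> x Fx i; have /= := FM (Num.max 1 (M0 + 1)) _ x Fx.
rewrite lt_max ltrDl ltr01 orbT => /(_ isT); apply: le_trans.
rewrite [leRHS]mx_normrE.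
by apply: (le_bigmax _ (fun ij : 'I_1 * 'I_n => `|x ij.1 ij.2|) (ord0, i)).
Qed.

(** The set whose infimum is [lower_idim], named so that it can be passed as a family in [theta] to
    [interpolated_inf]. *)
Definition lower_admissible {R : realType} {n : nat} (F : set 'rV[R]_n)
    (theta : R) : set R :=
  [set s | 0 <= s /\ forall eps, 0 < eps -> forall delta0, 0 < delta0 ->
    exists delta, 0 < delta <= delta0 /\ has_cover F theta delta s eps].

Definition upper_admissible {R : realType} {n : nat} (F : set 'rV[R]_n)
    (theta : R) : set R :=
  [set s | 0 <= s /\ forall eps, 0 < eps -> exists delta0, 0 < delta0 /\
    forall delta, 0 < delta <= delta0 -> has_cover F theta delta s eps].

(** A grid of cubes of diameter [delta] has sum at most [K * M^n * delta^(s - n)], which tends to 0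
    with [delta]. *)
Lemma upper_admissible_gt_dim {R : realType} {n : nat} (F : set 'rV[R]_n)
    (phi s : R) : (0 < n)%N -> bounded_set F ->
  0 <= phi <= 1 -> n%:R < s -> upper_admissible F phi s.
Proof.
move=> n0 /bounded_set_coord[M M1 FM] p01 ns.
split=> [|eps eps0]; first exact: le_trans (ltW ns).
set K := box_cst R n.
have K0 : 0 < K by exact: box_cst_gt0.
have M0 : 0 < M by exact: lt_le_trans M1.
pose C := K * M ^+ n; have C0 : 0 < C by rewrite mulr_gt0// exprn_gt0.
have sn0 : 0 < s - n%:R by rewrite subr_gt0.
(* The second term solves [C * delta^(s - n) = eps] for [delta]. *)
exists (Num.min 1 ((eps / C) `^ (s - n%:R)^-1)); split.
  by rewrite lt_min ltr01 powR_gt0// divr_gt0.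
move=> delta; rewrite le_min => /and3P[d0 d1 dC].
have d01 : 0 < delta <= 1 by rewrite d0.
apply: (has_cover_le F phi phi delta s
  (K * (M / delta) ^+ n * delta `^ s) eps) => //.
- by rewrite lexx andbT; case/andP: p01.
- rewrite exprMn exprVn -[delta ^+ n]powR_mulrn ?(ltW d0)//.
  rewrite mulrA -mulrA [_^-1 * _]mulrC -powRB ?(gt_eqF d0) ?implybT//.
  rewrite -ler_pdivlMl// mulrC.
  rewrite -[leRHS]powRr1 ?divr_ge0 ?(ltW eps0) ?(ltW C0)//.
  rewrite -[X in _ <= _ `^ X](mulVf (lt0r_neq0 sn0)) powRrM.
  by apply: ge0_ler_powR; rewrite ?nnegrE ?powR_ge0// ltW.
- apply: (has_cover_box F 0 M) => //; first exact: le_trans M1.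
  by move=> x Fx i; rewrite mxE subr0; exact: FM.
Qed.

Lemma upper_admissible_lower {R : realType} {n : nat} (F : set 'rV[R]_n)
    (theta : R) : upper_admissible F theta `<=` lower_admissible F theta.
Proof.
move=> s [s0 Fs]; split=> // eps /Fs[delta1 [d10 Fd]] delta0 d00.
exists (Num.min delta0 delta1).
rewrite lt_min d00 d10 ge_min lexx; split=> //; apply: Fd.
by rewrite lt_min d00 d10 ge_min lexx orbT.
Qed.

Lemma lower_admissible_le {R : realType} {n : nat} (F : set 'rV[R]_n)
    (theta phi : R) : 0 <= theta <= phi ->
  lower_admissible F phi `<=` lower_admissible F theta.
Proof.
move=> tp s [s0 Fs]; split=> // eps eps0 delta0 d00.
(* Capping at 1 puts [delta] where the lower scales are monotone in [theta]. *)
have d10 : 0 < Num.min 1 delta0 by rewrite lt_min ltr01.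
have [delta [/andP[d0]]] := Fs _ eps0 _ d10.
rewrite le_min => /andP[d1 dd0] Fd; exists delta; split; first by rewrite d0.
by apply: has_cover_le Fd => //; rewrite d0.
Qed.

Lemma upper_admissible_le {R : realType} {n : nat} (F : set 'rV[R]_n)
    (theta phi : R) : 0 <= theta <= phi ->
  upper_admissible F phi `<=` upper_admissible F theta.
Proof.
move=> tp s [s0 Fs]; split=> // eps /Fs[delta0 [d00 Fd]].
exists (Num.min 1 delta0); split; first by rewrite lt_min ltr01.
move=> delta; rewrite le_min => /and3P[d0 d1 dd0].
apply: (has_cover_le F theta phi delta s eps eps) => //; [|apply: Fd];
  by rewrite d0.
Qed.

Lemma refined_exponent_ge0 {R : realType} (theta phi s d : R) :
  0 < theta -> theta < phi -> 0 <= s <= d -> 0 <= d - theta / phi * (d - s).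
Proof.
move=> t0 tp /andP[s0 sd]; have p0 : 0 < phi by exact: lt_trans tp.
have : theta / phi <= 1 by rewrite ler_pdivrMr// mul1r ltW.
nra.
Qed.

Lemma lower_admissible_refine {R : realType} {n : nat} (F : set 'rV[R]_n)
    (theta phi s : R) : (0 < n)%N ->
  0 < theta -> theta < phi -> phi <= 1 -> s <= n%:R ->
  lower_admissible F theta s ->
  lower_admissible F phi (n%:R - theta / phi * (n%:R - s)).
Proof.
move=> n0 t0 tp p1 sn [s0 Fs]; split=> [|eps eps0 delta0 d00].
  by apply: refined_exponent_ge0; rewrite ?s0.
set K := box_cst R n.
have K0 : 0 < K by exact: box_cst_gt0.
have d10 : 0 < Num.min 1 delta0 by rewrite lt_min ltr01.
have [delta [/andP[d0]]] := Fs _ (divr_gt0 eps0 K0) _ d10.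
rewrite le_min => /andP[d1 dd0] Fd; exists (delta `^ (phi / theta)); split.
  rewrite powR_gt0//=; apply: le_trans dd0; apply: ge1r_powR.
    by rewrite d0.
  by rewrite ler_pdivlMr// mul1r ltW.
have -> : eps = K * (eps / K) by rewrite mulrC divfK// gt_eqF.
by apply: has_cover_refine => //; rewrite d0.
Qed.

(** Every small scale [delta'] has to be reached, so the refinement is run backwards, from
    [delta'^(theta / phi)]. *)
Lemma upper_admissible_refine {R : realType} {n : nat} (F : set 'rV[R]_n)
    (theta phi s : R) : (0 < n)%N ->
  0 < theta -> theta < phi -> phi <= 1 -> s <= n%:R ->
  upper_admissible F theta s ->
  upper_admissible F phi (n%:R - theta / phi * (n%:R - s)).
Proof.
move=> n0 t0 tp p1 sn [s0 Fs]; split=> [|eps eps0].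
  by apply: refined_exponent_ge0; rewrite ?s0.
set K := box_cst R n.
have K0 : 0 < K by exact: box_cst_gt0.
have p0 : 0 < phi by exact: lt_trans tp.
have [delta0 [d00 Fd]] := Fs _ (divr_gt0 eps0 K0).
exists (Num.min 1 delta0 `^ (phi / theta)); split.
  by rewrite powR_gt0// lt_min ltr01.
move=> delta' /andP[d'0 d'm]; pose delta := delta' `^ (theta / phi).
have d0 : 0 < delta by exact: powR_gt0.
have : delta <= Num.min 1 delta0.
  have m0 : 0 <= Num.min 1 delta0 by rewrite le_min ler01 ltW.
  have e1 : 1 = phi / theta * (theta / phi) by field; rewrite !gt_eqF.
  rewrite -[leRHS]powRr1// [X in _ <= _ `^ X]e1 powRrM.
  apply: ge0_ler_powR; rewrite ?nnegrE ?powR_ge0 ?(ltW d'0)//.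
  by rewrite divr_ge0// ltW.
rewrite le_min => /andP[d1 dd0].
have -> : eps = K * (eps / K) by rewrite mulrC divfK// gt_eqF.
have -> : delta' = delta `^ (phi / theta).
  rewrite -powRrM -[LHS]powRr1 ?(ltW d'0)//.
  by congr (_ `^ _); field; rewrite !gt_eqF.
by apply: has_cover_refine => //; [|apply: Fd]; rewrite d0.
Qed.

(** * Interpolation and continuity of the infima *)

(* Stated for abstract families [A theta] of exponents, so that it applies to
   both the lower and the upper dimensions. *)
Lemma interpolated_inf {R : realType} (A : R -> set R) (d : R) :
  (forall theta : R, 0 <= theta <= 1 -> A theta `<=` [set s | 0 <= s]) ->
  (forall theta s : R, 0 <= theta <= 1 -> d < s -> A theta s) ->
  (forall theta phi : R, 0 <= theta <= phi -> A phi `<=` A theta) ->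
  (forall theta phi s : R, 0 < theta -> theta < phi -> phi <= 1 -> s <= d ->
    A theta s -> A phi (d - theta / phi * (d - s))) ->
  let D (theta : R) := ereal_inf [set s%:E | s in A theta] in
  (forall theta phi : R, 0 <= theta -> theta < phi -> phi <= 1 ->
    (D theta <= D phi)%E /\
    (D phi <= D theta + (1 - theta / phi)%:E * (d%:E - D theta))%E) /\
  {within `]0, 1], continuous D}.
Proof.
move=> A_ge0 A_gtd A_le A_refine D.
have D_ge0 (theta : R) : 0 <= theta <= 1 -> (0%:E <= D theta)%E.
  move=> t01; apply: le_ereal_inf_tmp => _ [s As <-].
  by rewrite lee_fin; exact: A_ge0 As.
have D_led (theta : R) : 0 <= theta <= 1 -> (D theta <= d%:E)%E.
  move=> t01; apply/lee_addgt0Pr => e e0; apply: ge_ereal_inf.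
  exists (d + e)%:E => //; exists (d + e) => //.
  by apply: A_gtd => //; rewrite ltrDl.
pose f (theta : R) := fine (D theta).
have DE (theta : R) : 0 <= theta <= 1 -> D theta = (f theta)%:E.
  move=> t01; rewrite fineK// ge0_fin_numE ?D_ge0//.
  exact: le_lt_trans (D_led _ t01) (ltry _).
have f_ge0 (theta : R) : 0 <= theta <= 1 -> 0 <= f theta.
  by move=> t01; rewrite -lee_fin -DE// D_ge0.
have f_led (theta : R) : 0 <= theta <= 1 -> f theta <= d.
  by move=> t01; rewrite -lee_fin -DE// D_led.
have f_le (theta phi : R) : 0 <= theta -> theta < phi -> phi <= 1 ->
    f theta <= f phi.
  move=> t0 tp p1; rewrite -lee_fin -!DE; [|lra|lra].
  by apply: ereal_inf_le_tmp; apply: image_subset; apply: A_le; lra.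
have f_interp (theta phi : R) : 0 <= theta -> theta < phi -> phi <= 1 ->
    f phi <= f theta + (1 - theta / phi) * (d - f theta).
  (* At [theta = 0] the factor is 1 and the bound reduces to [f phi <= d]. *)
  rewrite le_eqVlt => /predU1P[<-|t0] tp p1.
    by rewrite mul0r subr0 mul1r subrKC f_led//; lra.
  have p0 : 0 < phi by exact: lt_trans tp.
  have c0 : 0 < theta / phi by rewrite divr_gt0.
  (* The inequality is solved for [f theta], so that it becomes a lower bound to be checked on each
     [s] in [A theta]; for [s > d] it is trivial, as the left side is at most [d]. *)
  have : (d - (d - f phi) / (theta / phi) <= f theta).
    rewrite -lee_fin -DE; last lra.
    apply: le_ereal_inf_tmp => _ [s As <-]; rewrite lee_fin.
    have fpd : f phi <= d by apply: f_led; lra.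
    have [sd|ds] := leP s d; last first.
      have : 0 <= (d - f phi) / (theta / phi) by rewrite divr_ge0//; lra.
      lra.
    rewrite lerBlDl -lerBlDr ler_pdivlMr//.
    have : f phi <= d - theta / phi * (d - s).
      rewrite -lee_fin -DE; last lra.
      by apply: ge_ereal_inf; exists (d - theta / phi * (d - s))%:E => //;
        exists (d - theta / phi * (d - s)) => //; exact: A_refine.
    lra.
  rewrite lerBlDl -lerBlDr ler_pdivlMr//; lra.
split=> [theta phi t0 tp p1|].
  rewrite (DE theta) ?(DE phi); [|lra|lra].
  by rewrite -EFinB -EFinM -EFinD !lee_fin; split; [exact: f_le|exact: f_interp].
(* The interpolation bound gives [f b - f a <= (1 - a / b) * (d - f a)], and [f a >= 0] is
   dropped. *)
have f_lip (a b : R) : 0 < a -> a < b -> b <= 1 ->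
    0 <= f b - f a <= (b - a) / b * d.
  move=> a0 ab b1; have b0 : 0 < b by exact: lt_trans ab.
  have := f_le _ _ (ltW a0) ab b1; have := f_interp _ _ (ltW a0) ab b1.
  have -> : (b - a) / b = 1 - a / b by field; rewrite gt_eqF.
  have : 0 <= f a by apply: f_ge0; lra.
  have : a / b <= 1 by rewrite ler_pdivrMr// mul1r ltW.
  nra.
have d0 : 0 <= d by apply: le_trans (f_ge0 0 _) (f_led 0 _); lra.
apply/subspace_continuousP => a; rewrite /= in_itv/= => /andP[a0 a1].
rewrite /from_subspace DE; last lra.
(* All values on ]0, 1] are finite, so convergence is proved for the real function [f]. *)
apply: cvg_EFin.
  rewrite ?near_simpl near_withinE; near=> x => /=; rewrite in_itv/= => x01.
  by rewrite DE//; lra.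
apply/cvgrPdist_le => e e0; rewrite ?near_simpl near_withinE.
(* The Lipschitz constant at [a] is [d / a]; [d + 1] avoids dividing by zero when [d = 0]. *)
exists (e * a / (d + 1)); first by rewrite /= divr_gt0 ?mulr_gt0//; lra.
move=> x /= xa; rewrite in_itv/= => /andP[x0 x1]; rewrite -/(f x).
suff : `|f a - f x| <= `|a - x| / a * d.
  move=> /le_trans; apply.
  rewrite mulrAC ler_pdivrMr//.
  move: xa; rewrite ltr_pdivlMr; last lra.
  have := normr_ge0 (a - x); nra.
(* [f_lip] divides by the larger of the two points, which is at least [a] in either order. *)
have [ax|xa'|<-] := ltgtP a x; last by rewrite !subrr normr0 !mul0r.
- rewrite !(distrC a) !(distrC (f a)).
  have /andP[fx0 fx] := f_lip _ _ a0 ax x1.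
  rewrite !ger0_norm ?subr_ge0 ?(ltW ax)//; last by rewrite -subr_ge0.
  apply: le_trans fx _; apply: ler_wpM2r => //; apply: ler_wpM2l; first lra.
  by rewrite lef_pV2 ?posrE// ltW.
- have /andP[fx0 fx] := f_lip _ _ x0 xa' a1.
  by rewrite !ger0_norm// subr_ge0 ltW.
Unshelve. all: by end_near. Qed.

Theorem proposition2p1 (R : realType) (n : nat) (F : set 'rV[R]_n)
  (n_gt0 : (0 < n)%N) (F_neq0 : F !=set0) (F_bounded : bounded_set F) :
  (forall theta phi : R, 0 <= theta -> theta < phi -> phi <= 1 ->
    ((lower_idim F theta <= lower_idim F phi)%E /\
     (lower_idim F phi <= lower_idim F theta
        + (1 - theta / phi)%:E * (n%:R%:E - lower_idim F theta))%E) /\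
    ((upper_idim F theta <= upper_idim F phi)%E /\
     (upper_idim F phi <= upper_idim F theta
        + (1 - theta / phi)%:E * (n%:R%:E - upper_idim F theta))%E)) /\
  {within `]0, 1], continuous (fun theta : R => lower_idim F theta)} /\
  {within `]0, 1], continuous (fun theta : R => upper_idim F theta)}.
Proof.
have [lower_bounds lower_cont] := interpolated_inf (lower_admissible F) n%:R
  (fun theta _ s Fs => Fs.1)
  (fun theta s t01 ns => upper_admissible_lower F theta s
    (upper_admissible_gt_dim F theta s n_gt0 F_bounded t01 ns))
  (lower_admissible_le F)
  (fun theta phi s => lower_admissible_refine F theta phi s n_gt0).
have [upper_bounds upper_cont] := interpolated_inf (upper_admissible F) n%:R
  (fun theta _ s Fs => Fs.1)
  (fun theta s => upper_admissible_gt_dim F theta s n_gt0 F_bounded)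
  (upper_admissible_le F)
  (fun theta phi s => upper_admissible_refine F theta phi s n_gt0).
split; last by split.
move=> theta phi t0 tp p1.
by split; [exact: lower_bounds|exact: upper_bounds].
Qed.
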